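(* For all integers $n\geq k\geq 0$, \[ (-1)^n\mu_{2k,bd}(-1,n)>0,\qquad\text{where}\qquad \mu_{2k,bd}(-1,n)=\sum_{m=-\infty}^{\infty}\binom{m+k-1}{2k}(-1)^mM_{bd}(m,n). \]
   Context: A partition with designated summands is an integer partition in which, for each distinct part size occurring, exactly one of the parts of that size is tagged (designated). A bipartition of $n$ with designated summands is an ordered pair $(\lambda_1,\lambda_2)$ of partitions with designated summands with $|\lambda_1|+|\lambda_2|=n$. Fix a bijection $\Delta$ (such a bijection exists) between partitions of $N$ with designated summands and pairs $(\alpha,\beta)$ with $|\alpha|+|\beta|=N$, where $\alpha$ is an ordinary partition and $\beta$ is a partition into parts $\not\equiv\pm1 \pmod 6$. If $\Delta(\lambda_1)=(\alpha_1,\beta_1)$ and $\Delta(\lambda_2)=(\alpha_2,\beta_2)$, the $pd$-crank of $(\lambda_1,\lambda_2)$ is $\ell(\alpha_1)-\ell(\alpha_2)$, where $\ell(\alpha)$ is the number of parts of $\alpha$. Because $\Delta$ is a bijection, $M_{bd}(m,n)$, the number of bipartitions of $n$ with designated summands having $pd$-crank $m$, equals the number of quadruples $(\alpha_1,\beta_1,\alpha_2,\beta_2)$ with $\alpha_1,\alpha_2$ ordinary partitions, $\beta_1,\beta_2$ partitions into parts $\not\equiv\pm1\pmod 6$, total size $n$ and $\ell(\alpha_1)-\ell(\alpha_2)=m$. Equivalently, \[ \sum_{m\in\mathbb Z}\sum_{n\ge0}M_{bd}(m,n)z^mq^n=\frac{(q^6;q^6)_\infty^2}{(zq;q)_\infty(z^{-1}q;q)_\infty(q^2;q^2)_\infty^2(q^3;q^3)_\infty^2},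 \] where $(a;q)_\infty=\prod_{j\ge1}(1-aq^{j-1})$. For an integer $x$, $\binom{x}{2k}$ denotes the polynomial binomial coefficient $x(x-1)\cdots(x-2k+1)/(2k)!$ (equal to $1$ when $k=0$). *)

(* Defs.v *)
From HB Require Import structures.
From mathcomp Require Import all_boot all_order all_algebra finmap.
From mathcomp Require Import all_classical.

Set Implicit Arguments.
Unset Strict Implicit.
Unset Printing Implicit Defensive.

Import Order.TTheory GRing.Theory Num.Theory.

Local Open Scope ring_scope.

(* Parts are listed in nonincreasing order. *)
Definition is_partition (s : seq nat) : bool :=
  sorted geq s && all (ltn 0) s.

(* A part is a pair (size, tag).  Tagging different copies of the same size
   gives different objects, e.g. 2'+2 and 2+2'. *)
Definition is_pds (l : seq (nat * bool)) : bool :=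
  is_partition (unzip1 l) &&
  all (fun a => count_mem (a, true) l == 1%N) (unzip1 l).

Definition pds := {l : seq (nat * bool) | is_pds l}.
HB.instance Definition _ := Countable.on pds.

Definition pds_weight (l : pds) : nat := sumn (unzip1 (val l)).

Definition is_partition_pair (p : seq nat * seq nat) : bool :=
  [&& is_partition p.1, is_partition p.2
    & all (fun b => (b %% 6 != 1) && (b %% 6 != 5))%N p.2].

Definition partition_pair := {p : seq nat * seq nat | is_partition_pair p}.
HB.instance Definition _ := Countable.on partition_pair.

Definition pair_weight (p : partition_pair) : nat :=
  (sumn (val p).1 + sumn (val p).2)%N.

(* A weight-preserving bijection amounts to one bijection for each weight N. *)
Definition pds_bijection (Delta : pds -> partition_pair) : Prop :=
  bijective Delta /\ forall l, pair_weight (Delta l) = pds_weight l.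

Definition bipartitions (n : nat) : set (pds * pds) :=
  [set l | (pds_weight l.1 + pds_weight l.2)%N = n]%classic.

Definition pd_crank (Delta : pds -> partition_pair) (l : pds * pds) : int :=
  (size (val (Delta l.1)).1)%:Z - (size (val (Delta l.2)).1)%:Z.

(* [fset_set] of an infinite set is a dummy value; by [finite_bipartitions]
   below, this does not occur here. *)
Definition M_bd (Delta : pds -> partition_pair) (m : int) (n : nat) : nat :=
  #|` fset_set [set l | bipartitions n l /\ pd_crank Delta l = m]%classic |.

Definition poly_binom (x : int) (j : nat) : rat :=
  (\prod_(i < j) (x%:~R - i%:R)) / (j`!)%:R.

(* The sum over all integers m has finite support by [M_bd_eq0] below. *)
Definition mu_bd (Delta : pds -> partition_pair) (k n : nat) : rat :=
  \sum_(m \in [set: int])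
    (poly_binom (m + k%:Z - 1) (2 * k) * (-1) ^ m * (M_bd Delta m n)%:R).

Lemma size_le_sumn (s : seq nat) : all (ltn 0) s -> (size s <= sumn s)%N.
Proof.
elim: s => //= a s IH /andP[a0 /IH]; rewrite -add1n; exact: leq_add.
Qed.

Lemma finite_pds_le (n : nat) :
  finite_set [set l : pds | (pds_weight l <= n)%N]%classic.
Proof.
pose f (b : n.-bseq ('I_n.+1 * bool)) :=
  [seq (nat_of_ord p.1, p.2) | p <- bseqval b].
have fin : finite_set (f @` setT)%classic
  by apply: finite_image; exact: finite_finset.
have inj : {in (val @^-1` (f @` setT))%classic &,
    injective (val : pds -> seq (nat * bool))}.
  by move=> x y _ _; exact: val_inj.
apply: sub_finite_set (finite_preimage inj fin) => -[l lP] /=.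
rewrite /pds_weight /= => ln.
have /andP[/andP[_ lpos] _] := lP.
have sz : (size l <= n)%N.
  by rewrite -(size_map fst) (leq_trans (size_le_sumn lpos)).
pose g (p : nat * bool) := (inord p.1 : 'I_n.+1, p.2).
have szg : (size (map g l) <= n)%N by rewrite size_map.
exists (Bseq szg) => //; rewrite /f /= -map_comp -[RHS]map_id.
apply/eq_in_map => -[a b] abl /=; rewrite inordK // ltnS.
apply: leq_trans ln; rewrite (perm_sumn (perm_to_rem (map_f fst abl))) /=.
exact: leq_addr.
Qed.

Lemma finite_bipartitions (n : nat) : finite_set (bipartitions n).
Proof.
apply: sub_finite_set (finite_setX (finite_pds_le n) (finite_pds_le n)).
by move=> l /= <-; split; rewrite /= ?leq_addr ?leq_addl.
Qed.

Lemma size_Delta (Delta : pds -> partition_pair) (l : pds) :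
  pds_bijection Delta -> (size (val (Delta l)).1 <= pds_weight l)%N.
Proof.
case=> _ /(_ l) <-; rewrite /pair_weight.
have /and3P[/andP[_ H] _ _] := valP (Delta l).
by rewrite (leq_trans (size_le_sumn H)) ?leq_addr.
Qed.

Lemma M_bd_eq0 (Delta : pds -> partition_pair) (m : int) (n : nat) :
  pds_bijection Delta -> (n%:Z < `|m|)%R -> M_bd Delta m n = 0%N.
Proof.
move=> DP nm; rewrite /M_bd (_ : mkset _ = set0) ?fset_set0 ?cardfs0 //.
rewrite -subset0 => l [/= ln lm]; move: nm; rewrite -lm ltNge => /negP; apply.
rewrite /pd_crank (le_trans (ler_normB _ _)) // !ger0_norm // -PoszD lez_nat -ln.
by rewrite leq_add // size_Delta.
Qed.

(* Main.v *)
(** The statistic [mu(k, n) = (-1)^n mu_{2k,bd}(-1, n)] is the sum of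
    [(-1)^(n+c) B_k(c)], with [B_k(c) = binom(c+k-1, 2k)] and [c] the crank, over
    all quadruples of partitions of total size [n].  Weighing each quadruple by
    its size and removing [i] copies of a part [j] gives a recursion for
    [n mu(k, n)] in terms of [mu(k - r, n - i j)].  Removing a part of [alpha_1]
    or [alpha_2] shifts the crank by [i] or [-i], and
    [B_k(c+i) + B_k(c-i) = \sum_r v(i,r) B_{k-r}(c)], where
    [w^i + w^-i = \sum_r v(i,r) (w - 2 + w^-1)^r].  The negative terms have [i] odd
    and either [j] even or [j = 3 mod 6].  Those with [r = 0] cancel between the
    [alpha] and [beta] parts; those with [r > 0] have [j] even and are dominated by
    the terms at [(2i, j/2)] because [v(2i,r) >= 2 v(i,r)].  What survives at
    [i = j = 1] is at least [2 mu(k, n-1) + mu(k-1, n-1)], so induction on [n]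
    concludes. *)
Require Import Defs.
From mathcomp Require Import all_boot all_order all_algebra finmap.
From mathcomp Require Import all_classical zify ring.

Set Implicit Arguments.
Unset Strict Implicit.
Unset Printing Implicit Defensive.

Import Order.TTheory GRing.Theory Num.Theory.
Local Open Scope ring_scope.

(** * Central binomial coefficients under shifts of the crank *)

Lemma poly_binomS (x : int) (j : nat) :
  poly_binom (x + 1) j.+1 = poly_binom x j.+1 + poly_binom x j.
Proof.
rewrite /poly_binom big_ord_recl /= subr0.
(* Past its factor [x + 1], the product for [x + 1] is the one for [x]; Pascal's rule then reduces
   to [x + 1 = (x - j) + (j + 1)]. *)
have -> : \prod_(i < j) ((x + 1)%:~R - (bump 0 i)%:R)
        = \prod_(i < j) (x%:~R - i%:R) :> rat.
  by apply: eq_bigr => i _; rewrite /bump leq0n natrD rmorphD /=; ring.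
rewrite big_ord_recr /= factS natrM rmorphD /=.
set p := \prod_(i < j) _.
have h1 : 1 + j%:R != 0 :> rat by rewrite addrC natr1 pnatr_eq0.
have h2 : j`!%:R != 0 :> rat by rewrite pnatr_eq0 -lt0n fact_gt0.
rewrite -natr1; field.
by rewrite h2 addrC h1.
Qed.

(** This is [B_k] above; the offset [k - 1] centres it so that its second central difference in [m]
    is [B_(k-1)]. *)
Definition central_binom (k : nat) (m : int) : rat :=
  poly_binom (m + k%:Z - 1) (2 * k).

Lemma central_binom0 m : central_binom 0 m = 1.
Proof. by rewrite /central_binom /poly_binom muln0 big_ord0 divr1. Qed.

(** With [w] the shift of [m] by one, [w - 2 + w^-1] lowers [k] by one; this is Pascal's rule
    applied twice. *)
Lemma central_binomS k m :
  central_binom k.+1 (m + 1) + central_binom k.+1 (m - 1)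
  = 2 * central_binom k.+1 m + central_binom k m.
Proof.
rewrite /central_binom (_ : 2 * k.+1 = (2 * k).+2)%N; last by rewrite mulnS.
have -> : m + 1 + k.+1%:Z - 1 = (m + k%:Z - 1) + 1 + 1 by lia.
have -> : m - 1 + k.+1%:Z - 1 = m + k%:Z - 1 by lia.
have -> : m + k.+1%:Z - 1 = m + k%:Z - 1 + 1 by lia.
rewrite !poly_binomS; ring.
Qed.

(** For [k > 0] the top [k - 1] lies between 0 and [2k - 1], so one factor of the product
    vanishes. *)
Lemma central_binom_at0 k : central_binom k 0 = (k == 0)%:R.
Proof.
case: k => [|k]; first exact: central_binom0.
rewrite /central_binom /poly_binom (_ : 2 * k.+1 = k + k.+2)%N; last by lia.
have lt_k : (k < k + k.+2)%N by lia.
rewrite (bigD1 (Ordinal lt_k)) //=.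
by rewrite (_ : 0 + k.+1%:Z - 1 = k%:Z) ?subrr ?mul0r //; lia.
Qed.

(* [w ^ i + w ^ - i = \sum_r cheb i r * (w - 2 + w^-1) ^ r]; carrying the first
   difference in [i] along makes nonnegativity and convexity evident. *)
Fixpoint cheb_pair (i : nat) : (nat -> nat) * (nat -> nat) :=
  if i is i'.+1 then
    let v r := ((cheb_pair i').1 r + (cheb_pair i').2 r)%N in
    (v, fun r => ((cheb_pair i').2 r + if r is r'.+1 then v r' else 0)%N)
  else (fun r => (2 * (r == 0))%N, fun r => (r == 1)%N : nat).

Definition cheb i := (cheb_pair i).1.
Definition dcheb i := (cheb_pair i).2.

Lemma chebS i r : cheb i.+1 r = (cheb i r + dcheb i r)%N.
Proof. by []. Qed.

Lemma dchebS i r :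
  dcheb i.+1 r = (dcheb i r + if r is r'.+1 then cheb i.+1 r' else 0)%N.
Proof. by []. Qed.

Lemma cheb_rec0 i : cheb i 0 = 2%N.
Proof.
have d0 : forall i, dcheb i 0 = 0%N by elim=> // {}i IH; rewrite dchebS IH.
by elim: i => // i IH; rewrite chebS IH d0.
Qed.

(** Multiplying [w^(i+1) + w^-(i+1)] by [w + w^-1 = 2 + (w - 2 + w^-1)] gives the neighbours [i + 2]
    and [i]; compare coefficients. *)
Lemma cheb_recS i r :
  (cheb i.+2 r.+1 + cheb i r.+1 = 2 * cheb i.+1 r.+1 + cheb i.+1 r)%N.
Proof. rewrite chebS dchebS (chebS i r.+1); lia. Qed.

Lemma leq_dcheb r : {homo dcheb^~ r : i j / (i <= j)%N}.
Proof. by apply: homo_leq (leqnn) leq_trans _ => i; rewrite dchebS leq_addr. Qed.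

(** Differences grow with the index, so each step from [a + b] gains at least as much as the same
    step from [a]. *)
Lemma cheb_convex a b r : (cheb a r + cheb b r <= cheb (a + b) r + cheb 0 r)%N.
Proof.
elim: a => [|a IH]; first by rewrite addnC.
by rewrite addSn !chebS; have := leq_dcheb r (leq_addr b a); lia.
Qed.

(** Convexity at [a = b = i], where [cheb 0] vanishes at a positive index. At index 0 every [cheb]
    is 2 and the bound fails. *)
Lemma cheb_double i r : (2 * cheb i r.+1 <= cheb (2 * i) r.+1)%N.
Proof.
by have := cheb_convex i i r.+1; rewrite (_ : cheb 0 _ = 0%N) // addn0 !addnn -!mul2n.
Qed.

Opaque central_binom.

(** The expansion of [w^i + w^-i] in powers of [w - 2 + w^-1] acts on [B_k], each power lowering
    [k]; it stops at [r = k] because [B_0] is constant. *)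
Lemma central_binom_shift i k m :
  central_binom k (m + i%:Z) + central_binom k (m - i%:Z)
  = \sum_(r < k.+1) (cheb i r)%:R * central_binom (k - r) m.
Proof.
have [n] := ubnP i; elim: n => // n IH in i k m *; rewrite ltnS => le_in.
case: k => [|k].
  by rewrite !central_binom0 big_ord_recl big_ord0 cheb_rec0 central_binom0; ring.
case: i le_in => [_|[_|i lein]].
- rewrite big_ord_recl /= big1 => [|r _]; last by rewrite mul0r.
  by rewrite oppr0 addr0 subn0 /= addr0 -mulr2n mulr_natl.
- rewrite central_binomS !big_ord_recl /= big1 => [|r _]; last by rewrite mul0r.
  by rewrite subn0 subSS subn0 addr0 cheb_rec0 (_ : cheb 1 (bump 0 0) = 1%N) ?mul1r.
(* The second difference at [m + (i + 1)] and [m - (i + 1)] is solved for the outer value, leaving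
   only shifts by [i + 1] and [i]. *)
have e1 : central_binom k.+1 (m + i.+2%:Z) = 2 * central_binom k.+1 (m + i.+1%:Z)
     + central_binom k (m + i.+1%:Z) - central_binom k.+1 (m + i%:Z).
  have := central_binomS k (m + i.+1%:Z).
  have -> : m + i.+1%:Z + 1 = m + i.+2%:Z by lia.
  have -> : m + i.+1%:Z - 1 = m + i%:Z by lia.
  by move/(canRL (addrK _)).
have e2 : central_binom k.+1 (m - i.+2%:Z) = 2 * central_binom k.+1 (m - i.+1%:Z)
     + central_binom k (m - i.+1%:Z) - central_binom k.+1 (m - i%:Z).
  have := central_binomS k (m - i.+1%:Z).
  have -> : m - i.+1%:Z + 1 = m - i%:Z by lia.
  have -> : m - i.+1%:Z - 1 = m - i.+2%:Z by lia.
  by rewrite addrC; move/(canRL (addrK _)).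
have -> : central_binom k.+1 (m + i.+2) + central_binom k.+1 (m - i.+2%:Z)
  = 2 * (central_binom k.+1 (m + i.+1%:Z) + central_binom k.+1 (m - i.+1%:Z))
    + (central_binom k (m + i.+1%:Z) + central_binom k (m - i.+1%:Z))
    - (central_binom k.+1 (m + i%:Z) + central_binom k.+1 (m - i%:Z)).
  by rewrite e1 e2 mulrDr opprD addrACA [X in X + _ = _]addrACA.
rewrite !IH ?(ltnW lein) //.
(* The terms at [r = 0] balance as [2 = 2 * 2 - 2]; [cheb_recS] settles the others. *)
rewrite big_ord_recl (big_ord_recl k.+1 (fun r => (cheb i r)%:R * _)).
rewrite (big_ord_recl k.+1 (fun r => (cheb i.+2 r)%:R * _)) !cheb_rec0.
set s1 := \sum_(r < k.+1) _; set s2 := \sum_(r < k.+1) _.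
set s3 := \sum_(r < k.+1) _; set s4 := \sum_(r < k.+1) _.
suff -> : s4 = 2 * s1 + s2 - s3.
  by move: (central_binom _ m) s1 s2 s3 => c s1 s2 s3; ring.
rewrite /s1 /s2 /s3 /s4 mulr_sumr -big_split /= -sumrB; apply: eq_bigr => r _.
rewrite /bump leq0n add1n subSS.
have := cheb_recS i r => /(congr1 (fun n => n%:R : rat)).
rewrite natrD [RHS]natrD natrM => h.
by rewrite mulrA -mulrDl -mulrBl -h addrK.
Qed.

(** * Configurations of parts and removal of copies *)

Section Configurations.

Variables (I : finType) (sz : I -> nat) (sh : I -> int) (ok : pred I) (N : nat).
Hypothesis sz_gt0 : forall x, (0 < sz x)%N.

Implicit Types (f : {ffun I -> 'I_N.+1}) (g : int -> rat).

(** A configuration records multiplicities. The bound [N] makes the type finite and excludes nothing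
    of weight at most [N], since sizes are positive. *)
Definition conf_weight f : nat := (\sum_x f x * sz x)%N.
Definition conf_crank f : int := \sum_x sh x *+ f x.
Definition conf n f : bool :=
  (conf_weight f == n) && [forall x, ok x || (f x == 0%N :> nat)].
Definition conf_sum g n : rat := \sum_(f | conf n f) g (conf_crank f).

(** Beyond [N], [inord] falls back to 0, so faithful addition requires [f x + i <= N]. *)
Definition add_copies x i f : {ffun I -> 'I_N.+1} :=
  [ffun y => if y == x then inord (f x + i) else f y].
Definition del_copies x i f : {ffun I -> 'I_N.+1} :=
  [ffun y => if y == x then inord (f x - i) else f y].

Lemma conf_weight_ge x f : (f x * sz x <= conf_weight f)%N.
Proof. by rewrite /conf_weight (bigD1 x) //= leq_addr. Qed.

Lemma conf_weight_add x i f : (f x + i <= N)%N ->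
  conf_weight (add_copies x i f) = (conf_weight f + i * sz x)%N.
Proof.
move=> le_N; rewrite /conf_weight (bigD1 x) //= [in RHS](bigD1 x) //=.
rewrite ffunE eqxx inordK // mulnDl addnAC; congr (_ + _ + _)%N.
by apply: eq_bigr => y /negPf yx; rewrite ffunE yx.
Qed.

Lemma conf_crank_add x i f : (f x + i <= N)%N ->
  conf_crank (add_copies x i f) = conf_crank f + sh x *+ i.
Proof.
move=> le_N; rewrite /conf_crank (bigD1 x) //= [in RHS](bigD1 x) //=.
rewrite ffunE eqxx inordK // mulrnDr addrAC; congr (_ + _ + _).
by apply: eq_bigr => y /negPf yx; rewrite ffunE yx.
Qed.

Lemma add_copiesK x i f : (f x + i <= N)%N ->
  del_copies x i (add_copies x i f) = f.
Proof.
move=> le_N; apply/ffunP => y; rewrite !ffunE eqxx; case: eqP => [->|//].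
by apply: val_inj; rewrite /= !inordK ?addnK // ?ltnS ?addnK.
Qed.

Lemma del_copiesK x i f : (i <= f x)%N ->
  add_copies x i (del_copies x i f) = f.
Proof.
move=> le_i; have := ltn_ord (f x); rewrite ltnS => fxN.
apply/ffunP => y; rewrite !ffunE eqxx; case: eqP => [->|//].
by apply: val_inj; rewrite /= !inordK ?subnK // ltnS; lia.
Qed.

(** Deleting [i] copies of [x] is a bijection onto the configurations of the smaller weight, with
    inverse [add_copies]. *)
Lemma conf_sum_copies g n x i : (n <= N)%N -> ok x -> (i * sz x <= n)%N ->
  \sum_(f | conf n f && (i <= f x)%N) g (conf_crank f)
  = conf_sum (fun m => g (m + sh x *+ i)) (n - i * sz x)%N.
Proof.
move=> le_nN okx le_in; rewrite /conf_sum.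
(* No overflow: [f x + i <= (f x + i) * sz x <= n <= N]. *)
have bnd f : (conf_weight f <= n - i * sz x)%N -> (f x + i <= N)%N.
  move=> wf; have := conf_weight_ge x f; have := sz_gt0 x => s0 wx.
  apply: leq_trans (leq_pmulr _ s0) _; rewrite mulnDl; lia.
have conf_ok y f f' : (forall z, z != x -> f z = f' z) ->
    ok y || (f y == 0%N :> nat) -> ok y || (f' y == 0%N :> nat).
  by move=> ff'; case: (eqVneq y x) => [->|/ff' <- //]; rewrite okx.
rewrite (reindex_onto (add_copies x i) (del_copies x i)) /=; last first.
  by move=> f /andP[_ /del_copiesK].
apply: eq_big => [f|f]; last first.
  case/andP=> /andP[/andP[/eqP wf _] ifx] /eqP fK.
  rewrite conf_crank_add //.
  (* By [fK], [f x + i] is the multiplicity after the addition, hence at most [N]. *)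
  rewrite -fK ffunE eqxx inordK ?subnK //; have := ltn_ord (add_copies x i f x); lia.
apply/andP/idP => [[/andP[/andP[/eqP wf /forallP Hf] ifx] /eqP fK]|].
  have le_N : (f x + i <= N)%N.
    by rewrite -fK ffunE eqxx inordK ?subnK //; have := ltn_ord (add_copies x i f x); lia.
  rewrite /conf -wf conf_weight_add // addnK eqxx /=; apply/forallP => y.
  by apply: conf_ok (Hf y) => z /negPf zx; rewrite ffunE zx.
case/andP => /eqP wf /forallP Hf.
have le_N : (f x + i <= N)%N by rewrite bnd ?wf.
rewrite /conf conf_weight_add // wf subnK // eqxx add_copiesK // eqxx.
rewrite ffunE eqxx inordK // leq_addl !andbT /=; split=> //; apply/forallP => y.
by apply: conf_ok (Hf y) => z /negPf zx; rewrite ffunE zx.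
Qed.

(* Double counting: a configuration of weight [n] contains each [i <= f x]
   copies of [x], each weighing [sz x]. *)
Lemma conf_sum_rec g n : (n <= N)%N ->
  n%:R * conf_sum g n =
  \sum_(x | ok x) \sum_(i < N.+1 | (0 < i)%N && (i * sz x <= n)%N)
    (sz x)%:R * conf_sum (fun m => g (m + sh x *+ i)) (n - i * sz x)%N.
Proof.
move=> le_nN.
transitivity (\sum_(f | conf n f) \sum_(x | ok x)
    \sum_(i < N.+1 | (0 < i)%N && (i <= f x)%N) (sz x)%:R * g (conf_crank f)).
  rewrite mulr_sumr; apply: eq_bigr => f /andP[/eqP wf /forallP Hf].
  rewrite -{1}wf /conf_weight natr_sum mulr_suml [RHS]big_mkcond /=.
  apply: eq_bigr => x _; have := Hf x; case: ifP => [_ _|_ /= /eqP->]; last first.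
    by rewrite mul0n mul0r.
  rewrite sumr_const -mulrnAl -mulrnA mulnC; congr (_ %:R * _); congr (_ * _)%N.
  have := ltn_ord (f x); move: (f x : nat) => a; rewrite ltnS => aN.
  rewrite -sum1_card big_mkcond /=.
  rewrite -(big_mkord xpredT (fun i => if (0 < i <= a)%N then 1 else 0)%N).
  rewrite (big_cat_nat (n := a.+1)) //= [X in (_ + X)%N]big_nat_cond.
  rewrite [X in (_ + X)%N]big1 ?addn0; last first.
    by move=> i /andP[/andP[ai _] _]; rewrite [(i <= a)%N]leqNgt ai andbF.
  rewrite big_nat_recl //= add0n.
  rewrite (eq_big_nat _ _ (F2 := fun=> 1%N)); first by rewrite sum_nat_const_nat; lia.
  by move=> i ia; rewrite /= (proj2 (andP ia)).
rewrite exchange_big /=; apply: eq_bigr => x okx.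
rewrite (exchange_big_dep (fun i : 'I_N.+1 => (0 < i)%N)) /=; last by move=> f i _ /andP[].
rewrite big_mkcondr /=; apply: eq_bigr => i i0; rewrite i0 /=; case: ifP => lei.
  by rewrite -mulr_sumr conf_sum_copies.
(* If [i * sz x > n], no configuration of weight [n] contains [i] copies of [x]. *)
apply: big1 => f /andP[/andP[/eqP wf _] ifx]; have := conf_weight_ge x f.
by rewrite wf => /(leq_trans (leq_mul ifx (leqnn (sz x)))); rewrite lei.
Qed.

End Configurations.

(** * The recursion for quadruples of partitions *)

Definition signed_binom k (m : int) : rat := central_binom k m * (-1) ^ m.

Lemma signed_binom_shift i k m :
  signed_binom k (m + i%:Z) + signed_binom k (m - i%:Z)
  = (-1) ^+ i * \sum_(r < k.+1) (cheb i r)%:R * signed_binom (k - r) m.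
Proof.
rewrite /signed_binom.
under eq_bigr => r _ do rewrite mulrA.
rewrite -mulr_suml -central_binom_shift.
have e : (-1 : rat) ^ (- i%:Z) = (-1) ^+ i by rewrite -exprnN invr_sign.
rewrite !expfzDr ?oppr_eq0 ?oner_eq0 // e -exprnP.
move: (central_binom k (m + i)) (central_binom k (m - i%:Z)) => a b.
by move: ((-1) ^ m) ((-1) ^+ i) => c d; ring.
Qed.

Definition beta_part (b : nat) : bool := (b %% 6 != 1)%N && (b %% 6 != 5)%N.

(* [(s, b, j)] stands for the part [j + 1] in [alpha_1], [alpha_2] (when [b] is
   false) or [beta_1], [beta_2] (when [b] is true), the index being [1] iff [s]. *)
Definition quad_part (N : nat) := (bool * bool * 'I_N)%type.
Definition quad_size N (x : quad_part N) : nat := x.2.+1.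
Definition quad_shift N (x : quad_part N) : int :=
  if x.1.2 then 0 else if x.1.1 then 1 else -1.
Definition quad_ok N (x : quad_part N) : bool := x.1.2 ==> beta_part x.2.+1.

Definition quad_sum N (g : int -> rat) n : rat :=
  conf_sum (@quad_size N) (@quad_shift N) (@quad_ok N) N g n.

Lemma big_quad_part (R : Type) (idx : R) (op : Monoid.com_law idx) N
    (F : quad_part N -> R) :
  \big[op/idx]_x F x =
  \big[op/idx]_j op (op (F (true, false, j)) (F (false, false, j)))
                    (op (F (true, true, j)) (F (false, true, j))).
Proof.
rewrite (eq_bigr (fun x => F (x.1, x.2))); last by case.
rewrite -(pair_bigA _ (fun c j => F (c, j))) /= exchange_big /=.
apply: eq_bigr => j _; rewrite (eq_bigr (fun c => F (c.1, c.2, j))); last by case.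
rewrite -(pair_bigA _ (fun s b => F (s, b, j))) /= !big_bool /=.
by rewrite Monoid.mulmACA Monoid.mulmC.
Qed.

(** For [N = n] this is [mu(k, n)] above; a fixed [N] keeps the induction on [n] within one type of
    configurations. *)
Definition mu_alt N k n : rat := (-1) ^+ n * quad_sum N (signed_binom k) n.

(** [p.1] is the size of a part and [p.2] the number of copies removed. *)
Definition part_copies N n : pred ('I_N.+1 * 'I_N.+1) :=
  fun p => [&& 0 < p.1, 0 < p.2 & p.1 * p.2 <= n]%N.


Lemma quad_sum_shift N k i n :
  quad_sum N (fun m => signed_binom k (m + 1 *+ i)) n
    + quad_sum N (fun m => signed_binom k (m + (-1) *+ i)) n
  = (-1) ^+ i
    * \sum_(r < k.+1) (cheb i r)%:R * quad_sum N (signed_binom (k - r)) n.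
Proof.
rewrite /quad_sum /conf_sum -big_split /=.
under [in RHS]eq_bigr => r _ do rewrite mulr_sumr.
rewrite exchange_big mulr_sumr; apply: eq_bigr => f _ /=.
by rewrite mulNrn natz signed_binom_shift.
Qed.

Arguments part_copies : clear implicits.

(** Removals from [alpha_1] and [alpha_2] combine through [quad_sum_shift]; those from [beta_1] and
    [beta_2] preserve the crank and coincide, whence the factor 2. *)
Lemma quad_sum_rec N k n : (n <= N)%N ->
  n%:R * quad_sum N (signed_binom k) n =
  \sum_(p | part_copies N n p) p.1%:R *
    ((-1) ^+ p.2 * (\sum_(r < k.+1)
        (cheb p.2 r)%:R * quad_sum N (signed_binom (k - r)) (n - p.1 * p.2)%N)
     + (2 * beta_part p.1)%:R * quad_sum N (signed_binom k) (n - p.1 * p.2)%N).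
Proof.
move=> le_nN; rewrite {1}/quad_sum conf_sum_rec //.
rewrite big_mkcond big_quad_part /=.
rewrite [RHS](eq_bigl (fun p : 'I_N.+1 * 'I_N.+1 => (0 < p.1)%N &&
  ((0 < p.2)%N && (p.2 * p.1 <= n)%N))); last by move=> p; rewrite /part_copies mulnC.
pose F (j i : nat) := j%:R *
    ((-1) ^+ i * (\sum_(r < k.+1)
        (cheb i r)%:R * quad_sum N (signed_binom (k - r)) (n - j * i)%N)
     + (2 * beta_part j)%:R * quad_sum N (signed_binom k) (n - j * i)%N).
rewrite -(pair_big_dep (fun j : 'I_N.+1 => 0 < j)%N
  (fun j i : 'I_N.+1 => (0 < i)%N && (i * j <= n)%N)
  (fun j i : 'I_N.+1 => F j i)) /=.
rewrite [RHS]big_mkcond big_ord_recl /= add0r; apply: eq_bigr => j _.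
rewrite /bump leq0n add1n /quad_ok /quad_size /quad_shift /=.
rewrite -big_split /=.
have -> : forall (b : bool) (x : rat), (if b then x else 0) = b%:R * x.
  by move=> [] x; rewrite ?mul1r ?mul0r.
rewrite -mulr2n -[X in _ + X = _]mulr_natl mulrA -natrM mulr_sumr -big_split /=.
apply: eq_bigr => i _; rewrite /F -quad_sum_shift !(mulnC i) /quad_sum.
rewrite -mulrDr mulrCA -mulrDr; congr (_ * (_ + _ * _)).
by apply: eq_bigr => f _; rewrite mul0rn addr0.
Qed.

(** The sign [(-1)^n] splits into [(-1)^(p.1 * p.2)] and the sign belonging to weight
    [n - p.1 * p.2]. *)
Lemma mu_alt_rec N k n : (n <= N)%N ->
  n%:R * mu_alt N k n =
  \sum_(p | part_copies N n p) p.1%:R *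
    ((-1) ^+ (p.1 * p.2 + p.2) *
       (\sum_(r < k.+1) (cheb p.2 r)%:R * mu_alt N (k - r) (n - p.1 * p.2)%N)
     + (-1) ^+ (p.1 * p.2) * (2 * beta_part p.1)%:R
       * mu_alt N k (n - p.1 * p.2)%N).
Proof.
move=> le_nN; rewrite /mu_alt mulrCA quad_sum_rec // mulr_sumr.
apply: eq_bigr => p /and3P[_ _ le_pn].
rewrite mulrCA mulrDr; congr (_ * (_ + _)).
  under [in RHS]eq_bigr => r _ do rewrite mulrCA.
  rewrite -mulr_sumr !mulrA -!exprD; congr (_ * _).
  by rewrite addnAC subnKC.
by rewrite [RHS]mulrACA -exprD subnKC.
Qed.

(** * Domination of the negative terms and positivity *)

Lemma ler_sum_inj (T : finType) (A B : {pred T}) (h : T -> T) (y z : T -> rat) :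
  {in B &, injective h} -> {in B, forall x, h x \in A} ->
  {in A, forall x, 0 <= z x} -> {in B, forall x, y x <= z (h x)} ->
  \sum_(x in B) y x <= \sum_(x in A) z x.
Proof.
move=> h_inj hBA z_ge0 le_yz.
have le_yzh : \sum_(x in B) y x <= \sum_(x in B) z (h x) by apply: ler_sum.
apply: le_trans le_yzh _.
rewrite -(big_imset z h_inj) /= (bigID [in [set h x | x in B]] [in A]) /=.
rewrite [X in _ <= X + _](eq_bigl [in [set h x | x in B]]); last first.
  by move=> x /=; rewrite andb_idl // => /imsetP[b bB ->]; apply: hBA.
by rewrite lerDl sumr_ge0 // => x /andP[/z_ge0].
Qed.

Lemma part_copies_lt N n p : part_copies N n p -> (n - p.1 * p.2 < n)%N.
Proof. by case/and3P; case: p => i j /=; nia. Qed.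

(** The removal of a single part 1: the term kept as the lower bound, at weight [n - 1]. *)
Definition single_copy N : 'I_N.+1 * 'I_N.+1 := (inord 1, inord 1).

Arguments single_copy : simpl never.

Lemma single_copyE N : (0 < N)%N -> 
  ((single_copy N).1 = 1%N :> nat) * ((single_copy N).2 = 1%N :> nat).
Proof. by move=> N0; rewrite /single_copy /= !inordK. Qed.

Lemma single_copyP N n : (0 < n <= N)%N -> part_copies N n (single_copy N).
Proof.
move=> /andP[n0 nN]; have N0 := leq_trans n0 nN.
by rewrite /part_copies !single_copyE.
Qed.

(* The negative terms have [p.2] odd and [p.1] even; each is outweighed by the
   positive term at [(p.1 / 2, 2 * p.2)], thanks to [cheb_double]. *)
Lemma ge_cheb_sum N n r (tau : nat -> rat) : (0 < n <= N)%N ->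
  (forall d, (d < n)%N -> 0 <= tau d) ->
  (cheb 1 r.+1)%:R * tau n.-1 <=
  \sum_(p | part_copies N n p) p.1%:R *
    ((-1) ^+ (p.1 * p.2 + p.2) * ((cheb p.2 r.+1)%:R * tau (n - p.1 * p.2)%N)).
Proof.
move=> n0N tau_ge0; have [n0 nN] := andP n0N; have N0 := leq_trans n0 nN.
pose G (p : 'I_N.+1 * 'I_N.+1) :=
  p.1%:R * ((cheb p.2 r.+1)%:R * tau (n - p.1 * p.2)%N).
pose neg (p : 'I_N.+1 * 'I_N.+1) := odd p.2 && ~~ odd p.1.
have G_ge0 p : part_copies N n p -> 0 <= G p.
  by move/part_copies_lt/tau_ge0 => H; rewrite /G !mulr_ge0.
rewrite (eq_bigr (fun p => if neg p then - G p else G p)); last first.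
  move=> p _; rewrite mulrCA -/(G p) -signr_odd oddD oddM /neg.
  by case: (odd p.1) (odd p.2) => [] []; rewrite ?mulN1r ?mul1r.
rewrite (bigID neg) /= [X in _ + X](bigD1 (single_copy N)) /=; last first.
  by rewrite single_copyP // /neg !single_copyE.
rewrite [X in _ + (X + _)](_ : _ = (cheb 1 r.+1)%:R * tau n.-1); last first.
  by rewrite /neg /G !single_copyE //= mul1r muln1 subn1.
rewrite addrCA lerDl.
rewrite (eq_bigr (fun p => - G p)); last by move=> p /andP[_ ->].
rewrite sumrN addrC subr_ge0.
rewrite [leRHS](eq_bigr G); last by move=> p /andP[/andP[_ /negPf->]].
(* [h] preserves [p.1 * p.2], so the two matched terms carry the same value of [tau]. *)
pose h (p : 'I_N.+1 * 'I_N.+1) : 'I_N.+1 * 'I_N.+1 :=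
  (inord (p.1)./2, inord (2 * p.2)).
have hE p : part_copies N n p -> neg p ->
    ((h p).1 = (p.1)./2 :> nat) * ((h p).2 = (2 * p.2)%N :> nat)
    * (p.1 = (2 * (p.1)./2)%N :> nat) * (0 < (p.1)./2)%N.
  case: p => [[j jN] [i iN]] /and3P[/= j0 i0 le_n] /andP[/= oi /negPf oj].
  have j2 : j = (2 * j./2)%N by rewrite -{1}(odd_double_half j) oj add0n mul2n.
  have le_j : (2 * i * j./2 <= n)%N by rewrite mulnAC -j2.
  have j20 : (0 < j./2)%N by lia.
  have i_le : (2 * i <= n)%N by apply: leq_trans le_j; apply: leq_pmulr.
  have j_le : (j./2 <= n)%N by apply: leq_trans le_j; apply: leq_pmull; lia.
  by rewrite /h /= !inordK ?ltnS ?(leq_trans _ nN) //; do !split.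
apply: (@ler_sum_inj _ _ _ h).
- move=> p q; rewrite !unfold_in => /andP[pp np] /andP[pq nq].
  have := hE p pp np; have := hE q pq nq.
  move=> [[[q1 q2] q3] _] [[[p1 p2] p3] _] e.
  move: q1 q2; rewrite -e p1 p2.
  case: p q p3 q3 {pp np pq nq p1 p2 e} => p1 p2 [q1 q2] /= p3 q3 e1 e2.
  by congr (_, _); apply: val_inj => /=; lia.
- move=> p; rewrite !unfold_in => /andP[pp np].
  have := hE p pp np => -[[[e1 e2] e3] e4].
  have [_ p2 le_n] := and3P pp.
  rewrite /part_copies /neg !e1 !e2 e4 muln_gt0 p2 mulnA [(_ * 2)%N]mulnC -e3 le_n.
  rewrite oddM /=; apply/eqP => /(congr1 (fun q => nat_of_ord q.2)).
  by rewrite e2 single_copyE //; lia.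
- by move=> p; rewrite !unfold_in => /andP[/andP[pp _] _]; apply: G_ge0.
move=> p; rewrite !unfold_in => /andP[pp np].
have := hE p pp np => -[[[e1 e2] e3] e4].
rewrite /G e1 e2 mulnA [(_./2 * 2)%N]mulnC -e3 {1}e3 !mulrA.
apply: ler_wpM2r; first exact/tau_ge0/part_copies_lt.
by rewrite -!natrM ler_nat mulnAC mulnC leq_mul2l cheb_double orbT.
Qed.

(** The first sign is negative only for [p.1] even and [p.2] odd; then [p.1] is an admissible beta
    part and the second sign is positive. The second is negative only when both are odd, where the
    first is positive. So no coefficient is negative, and since 1 is not a beta part, [(1, 1)]
    contributes [2 * tau n.-1]. *)
Lemma ge_const_sum N n (tau : nat -> rat) : (0 < n <= N)%N ->
  (forall d, (d < n)%N -> 0 <= tau d) ->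
  2 * tau n.-1 <=
  \sum_(p | part_copies N n p) p.1%:R *
    ((-1) ^+ (p.1 * p.2 + p.2) * (2 * tau (n - p.1 * p.2)%N)
     + (-1) ^+ (p.1 * p.2) * (2 * beta_part p.1)%:R * tau (n - p.1 * p.2)%N).
Proof.
move=> n0N tau_ge0; have [n0 nN] := andP n0N; have N0 := leq_trans n0 nN.
rewrite (bigD1 (single_copy N)) /=; last exact: single_copyP.
rewrite !single_copyE //= mul1r mulr0 mul0r addr0 expr2 mulrNN !mul1r subn1.
rewrite lerDl sumr_ge0 // => p /andP[/part_copies_lt/tau_ge0].
move: (tau _) => t t0 _; rewrite mulr_ge0 // mulrA -mulrDl mulr_ge0 //.
rewrite natrM mulrCA [_ * 2%:R]mulrC -mulrDr mulr_ge0 //.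
rewrite -(signr_odd _ (_ + _)) -(signr_odd _ (_ * _)) oddD oddM.
have : ~~ odd p.1 -> beta_part p.1 by rewrite /beta_part; lia.
by case: (odd p.1) (odd p.2) (beta_part p.1) => [] [] [] // ->.
Qed.

Lemma mu_alt0 N k : mu_alt N k 0 = (k == 0)%:R.
Proof.
rewrite /mu_alt expr0 mul1r /quad_sum /conf_sum.
rewrite (bigD1 [ffun=> ord0]) /=; last first.
  rewrite /conf /conf_weight big1 ?eqxx => [|x _]; last by rewrite ffunE mul0n.
  by apply/forallP => x; rewrite ffunE orbT.
rewrite big1 ?addr0 => [|f /andP[/andP[/eqP wf _] /eqP []]]; last first.
  apply/ffunP => x; rewrite ffunE; apply: val_inj => /=.
  by have := conf_weight_ge (@quad_size N) x f; rewrite wf leqn0 muln_eq0 orbF => /eqP.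
rewrite /conf_crank big1 => [|x _]; last by rewrite ffunE mulr0n.
by rewrite /signed_binom central_binom_at0 expr0z mulr1.
Qed.

(** Nonnegativity is carried for every [k], since the recursion also reaches weights smaller than
    the index. *)
Lemma mu_alt_ge0_gt0 N n : (n <= N)%N ->
  forall k, 0 <= mu_alt N k n /\ ((k <= n)%N -> 0 < mu_alt N k n).
Proof.
elim/ltn_ind: n => -[_ _ k|n IH le_nN k].
  by rewrite mu_alt0 ler0n; split=> //; rewrite leqn0 => /eqP->.
have n0N : (0 < n.+1 <= N)%N by [].
have mu_ge0 l d : (d < n.+1)%N -> 0 <= mu_alt N l d.
  by move=> dn; case: (IH d dn _ l) => //; apply: leq_trans le_nN; apply: ltnW.
(* The terms at [r = 0] and the beta parts give the first summand; each [r > 0] gives one term of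
   the sum. *)
have step : 2 * mu_alt N k n
    + \sum_(r < k) (cheb 1 r.+1)%:R * mu_alt N (k - r.+1) n
    <= n.+1%:R * mu_alt N k n.+1.
  rewrite mu_alt_rec //.
  under [leRHS]eq_bigr => p _ do
    rewrite big_ord_recl cheb_rec0 subn0 [_ ^+ _ * (_ + _)]mulrDr addrAC mulrDr.
  rewrite big_split /=; apply: lerD.
    exact: (ge_const_sum n0N (mu_ge0 k)).
  under [leRHS]eq_bigr => p _ do rewrite !mulr_sumr.
  rewrite exchange_big /=; apply: ler_sum => r _.
  exact: (ge_cheb_sum _ n0N (mu_ge0 _)).
have n1_gt0 : 0 < n.+1%:R :> rat by rewrite ltr0n.
have sum_ge0 : 0 <= \sum_(r < k) (cheb 1 r.+1)%:R * mu_alt N (k - r.+1) n.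
  by apply: sumr_ge0 => r _; rewrite mulr_ge0 // mu_ge0.
split=> [|le_kn]; rewrite -(pmulr_rge0 _ n1_gt0, pmulr_rgt0 _ n1_gt0).
  by apply: le_trans step; rewrite addr_ge0 // mulr_ge0 // mu_ge0.
apply: lt_le_trans step.
(* For [k <= n] the summand [2 * mu_alt N k n] is positive. For [k = n + 1] the term [mu_alt N n n]
   is, with coefficient [cheb 1 1 = 1]. *)
have [lt_kn|] := leqP k n.
  apply: ltr_wpDr => //; rewrite mulr_gt0 //.
  by case: (IH n (ltnSn n) _ k) => [|_ ->] //; apply: ltnW.
move=> lt_nk; have kE : k = n.+1 by apply/eqP; rewrite eqn_leq le_kn.
rewrite kE big_ord_recl /= subSS subn0.
apply: ltr_wpDl; first by rewrite mulr_ge0 ?mu_ge0.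
apply: ltr_pwDl.
  rewrite mul1r.
  by case: (IH n (ltnSn n) _ n) => [|_ ->] //; apply: ltnW.
by apply: sumr_ge0 => r _; rewrite mulr_ge0 // mu_ge0.
Qed.

(** * Partitions and their multiplicities *)

Lemma sum_count_mem n (s : seq nat) (w : nat -> nat) :
  all (fun a => 0 < a <= n)%N s ->
  (\sum_(j < n) count_mem j.+1 s * w j.+1 = \sum_(a <- s) w a)%N.
Proof.
elim: s => [|a s IH] /=; first by rewrite big_nil big1.
case/andP=> /andP[a0 an] /IH {}IH; rewrite big_cons -IH.
under eq_bigr => j _ do rewrite mulnDl.
rewrite big_split /=; congr (_ + _)%N.
have lt_a : (a.-1 < n)%N by rewrite prednK.
rewrite (bigD1 (Ordinal lt_a)) //= prednK // eqxx mul1n big1 ?addn0 // => j ja.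
case: eqP => [e|//]; case/eqP: ja; apply: val_inj; by rewrite /= e.
Qed.

Lemma leq_sumn_mem (s : seq nat) a : a \in s -> (a <= sumn s)%N.
Proof. by move=> a_s; rewrite (perm_sumn (perm_to_rem a_s)) /= leq_addr. Qed.

Lemma is_partition_inj n (s t : seq nat) :
  is_partition s -> is_partition t ->
  all (fun a => 0 < a <= n)%N s -> all (fun a => 0 < a <= n)%N t ->
  (forall j, (j < n)%N -> count_mem j.+1 s = count_mem j.+1 t) -> s = t.
Proof.
move=> /andP[ss _] /andP[st _] /allP sn /allP tn e.
apply: (sorted_eq (leT := geq)) => //; first by move=> x y z /=; lia.
  by move=> x y; rewrite /geq /=; lia.
apply/allP => a _ /=; apply/eqP.
have [an|] := boolP (0 < a <= n)%N.
  by case: a an => // a /andP[_ an]; apply: e.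
by move=> Na; rewrite !(count_memPn _) //; apply: contra Na; [apply: tn|apply: sn].
Qed.

Definition partition_of n (h : 'I_n -> nat) : seq nat :=
  sort geq (flatten [seq nseq (h j) j.+1 | j : 'I_n]).

Lemma mem_partition_of n (h : 'I_n -> nat) a :
  (a \in partition_of h) = [exists j : 'I_n, (a == j.+1) && (0 < h j)%N].
Proof.
rewrite mem_sort; apply/flatten_mapP/existsP => -[j].
  by move=> _; rewrite mem_nseq => /andP[hj aj]; exists j; rewrite aj.
by case/andP=> aj hj; exists j; rewrite ?mem_enum // mem_nseq hj.
Qed.

Lemma count_partition_of n (h : 'I_n -> nat) (j : 'I_n) :
  count_mem j.+1 (partition_of h) = h j.
Proof.
rewrite /partition_of count_sort count_flatten -map_comp sumnE big_map big_enum /=.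
rewrite (bigD1 j) //= count_nseq /= eqxx mul1n big1 ?addn0 // => i ij.
rewrite count_nseq /=; case: eqP => // -[e]; case/eqP: ij; exact: val_inj.
Qed.

Lemma partition_ofP n (h : 'I_n -> nat) : is_partition (partition_of h).
Proof.
apply/andP; split; first by apply: sort_sorted => x y; rewrite /geq /=; lia.
by apply/allP => a; rewrite mem_partition_of => /existsP[j /andP[/eqP-> _]].
Qed.

(** * Bipartitions as configurations *)

Section Quadruples.

Variables (Delta : pds -> partition_pair) (Delta_bij : pds_bijection Delta).

(** The flags [s] and [b] follow the convention of [quad_part]. *)
Definition quad_comp (l : pds * pds) (s b : bool) : seq nat :=
  let p := val (Delta (if s then l.1 else l.2)) in if b then p.2 else p.1.

Arguments quad_comp : simpl never.

Lemma quad_comp_partition l s b : is_partition (quad_comp l s b).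
Proof.
by rewrite /quad_comp; case: (Delta _) => /= p /and3P[p1 p2 _]; case: b.
Qed.

Lemma quad_comp_beta l s : all beta_part (quad_comp l s true).
Proof. by rewrite /quad_comp; case: (Delta _) => /= p /and3P[]. Qed.

Lemma quad_comp_weight l :
  (pds_weight l.1 + pds_weight l.2 =
   sumn (quad_comp l true false) + sumn (quad_comp l false false)
   + (sumn (quad_comp l true true) + sumn (quad_comp l false true)))%N.
Proof.
by case: Delta_bij => _ E; rewrite -!E /pair_weight /quad_comp addnACA.
Qed.

Lemma quad_comp_inj l l' :
  (forall s b, quad_comp l s b = quad_comp l' s b) -> l = l'.
Proof.
case: Delta_bij => /bij_inj Dinj _ e.
have De s : Delta (if s then l.1 else l.2) = Delta (if s then l'.1 else l'.2).
  apply: val_inj; have := e s true; have := e s false; rewrite /quad_comp.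
  by case: (val _) (val _) => [a b] [c d] /= -> ->.
by case: l l' e De => [a b] [c d] e De; congr (_, _); [apply: Dinj (De true)|apply: Dinj (De false)].
Qed.

Lemma quad_comp_bounded n l s b : (pds_weight l.1 + pds_weight l.2 = n)%N ->
  all (fun a => 0 < a <= n)%N (quad_comp l s b).
Proof.
move=> ln; apply/allP => a ain.
have /andP[_ /allP/(_ a ain)/= ->] := quad_comp_partition l s b.
apply: leq_trans (leq_sumn_mem ain) _; rewrite -ln quad_comp_weight.
by case: s b {ain} => [] []; lia.
Qed.

Definition quad_conf n (l : pds * pds) : {ffun quad_part n -> 'I_n.+1} :=
  [ffun x : quad_part n => inord (count_mem x.2.+1 (quad_comp l x.1.1 x.1.2))].

Lemma quad_confE n l (x : quad_part n) : (pds_weight l.1 + pds_weight l.2 = n)%N ->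
  quad_conf n l x = count_mem x.2.+1 (quad_comp l x.1.1 x.1.2) :> nat.
Proof.
move=> ln; rewrite ffunE inordK // ltnS; set s := quad_comp _ _ _.
have sn : (sumn s <= n)%N.
  by rewrite -ln quad_comp_weight {}/s; case: x.1.1; case: x.1.2; lia.
apply: leq_trans sn.
have /andP[_ /size_le_sumn] := quad_comp_partition l x.1.1 x.1.2.
exact/leq_trans/count_size.
Qed.

Lemma quad_conf_weight n l : (pds_weight l.1 + pds_weight l.2 = n)%N ->
  conf_weight (@quad_size n) (quad_conf n l) = n.
Proof.
move=> ln; rewrite /conf_weight.
under eq_bigr => x _ do rewrite quad_confE //.
rewrite big_quad_part /quad_size /= !big_split /=.
have E s b : (\sum_(j < n) count_mem j.+1 (quad_comp l s b) * j.+1)%N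
           = sumn (quad_comp l s b).
  by rewrite sumnE -(sum_count_mem id (quad_comp_bounded s b ln)).
by rewrite !E -quad_comp_weight.
Qed.

Lemma quad_conf_crank n l : (pds_weight l.1 + pds_weight l.2 = n)%N ->
  conf_crank (@quad_shift n) (quad_conf n l) = pd_crank Delta l.
Proof.
move=> ln; rewrite /conf_crank.
under eq_bigr => x _ do rewrite quad_confE //.
rewrite big_quad_part /quad_shift /=.
under eq_bigr => j _ do rewrite !mul0rn !addr0 mulNrn.
rewrite sumrB !sumrMnr.
have E s : (\sum_(j < n) count_mem j.+1 (quad_comp l s false))%N
         = size (quad_comp l s false).
  rewrite -sum1_size -(sum_count_mem (fun=> 1%N) (quad_comp_bounded s false ln)).
  by apply: eq_bigr => j _; rewrite muln1.
by rewrite !E !natz.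
Qed.

Lemma quad_conf_ok n l : (pds_weight l.1 + pds_weight l.2 = n)%N ->
  conf (@quad_size n) (@quad_ok n) n (quad_conf n l).
Proof.
move=> ln; rewrite /conf quad_conf_weight // eqxx /=.
apply/forallP => -[[s [] ] j]; rewrite /quad_ok //= quad_confE //= -implyNb.
apply/implyP => Nj; rewrite (count_memPn _) //; apply: contra Nj.
exact/allP/quad_comp_beta.
Qed.

Lemma quad_conf_inj n : {in [pred l | (pds_weight l.1 + pds_weight l.2 == n)%N] &,
  injective (quad_conf n)}.
Proof.
move=> l l'; rewrite !inE => /eqP ln /eqP ln' e; apply: quad_comp_inj => s b.
apply: (@is_partition_inj n); rewrite ?quad_comp_partition ?quad_comp_bounded //.
move=> j jn; have := quad_confE (s, b, Ordinal jn) ln.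
by rewrite e quad_confE.
Qed.

(** The multiplicities in [f] define four partitions; the two resulting pairs are pulled back
    through the inverse of [Delta]. *)
Lemma quad_conf_onto n (f : {ffun quad_part n -> 'I_n.+1}) :
  conf (@quad_size n) (@quad_ok n) n f ->
  exists2 l, (pds_weight l.1 + pds_weight l.2 = n)%N & quad_conf n l = f.
Proof.
case/andP=> /eqP wf /forallP Hf.
pose part s b := partition_of (fun j => f (s, b, j)).
have pairP s : is_partition_pair (part s false, part s true).
  rewrite /is_partition_pair !partition_ofP /=; apply/allP => a.
  rewrite mem_partition_of => /existsP[j /andP[/eqP-> fj]].
  by have := Hf (s, true, j); rewrite eqn0Ngt fj orbF.
case: (Delta_bij) => -[D' DK D'K] _.
pose l := (D' (Sub _ (pairP true)), D' (Sub _ (pairP false))).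
have lE s b : quad_comp l s b = part s b.
  by rewrite /quad_comp; case: s; rewrite D'K; case: b.
have ln : (pds_weight l.1 + pds_weight l.2 = n)%N.
  rewrite quad_comp_weight -wf !lE /conf_weight big_quad_part /quad_size /= !big_split /=.
  have E s b : sumn (part s b) = (\sum_(j < n) f (s, b, j) * j.+1)%N.
    rewrite sumnE -(@sum_count_mem n _ id) /=; last first.
      apply/allP => a; rewrite mem_partition_of => /existsP[j /andP[/eqP-> _]].
      exact: ltn_ord.
    by apply: eq_bigr => j _; rewrite count_partition_of.
  by rewrite !E.
exists l => //; apply/ffunP => -[[s b] j]; apply: val_inj.
by rewrite /= quad_confE //= lE count_partition_of.
Qed.

Lemma mu_bd_quad_sum k n : mu_bd Delta k n = quad_sum n (signed_binom k) n.
Proof.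
have finB := finite_bipartitions n.
pose D := fset_set (bipartitions n).
have inD l : (l \in D) = (pds_weight l.1 + pds_weight l.2 == n)%N.
  rewrite in_fset_set //; by apply/idP/eqP; rewrite inE.
pose A := [fset pd_crank Delta l | l in D]%fset.
have ME m : M_bd Delta m n = (\sum_(l <- D | pd_crank Delta l == m) 1)%N.
  rewrite /M_bd.
  have -> : fset_set [set l | bipartitions n l /\ pd_crank Delta l = m]%classic
          = [fset l in D | pd_crank Delta l == m]%fset.
    apply/fsetP => l; rewrite !inE /= in_fset_set; last first.
      by apply: sub_finite_set finB => x [].
    by apply/idP/andP; rewrite inE /= inD => -[/eqP ? /eqP ?].
  rewrite big_fset_condE /=.
  by rewrite cardfE -sum1_card big_seq_fsetE.
(* Outside the finite set [A] of attained cranks, [M_bd] vanishes. *)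
rewrite /mu_bd (fsbigTE A) => [|m mA]; last first.
  rewrite ME big_seq_cond big1 ?mulr0 // => l /andP[lD /eqP lm].
  by case/negP: mA; rewrite -lm; apply: in_imfset.
transitivity (\sum_(l <- D) signed_binom k (pd_crank Delta l)).
  rewrite (partition_big_imfset _ (pd_crank Delta)); apply: eq_bigr => m _.
  rewrite ME natr_sum mulr_sumr; apply: eq_bigr => l /eqP->.
  by rewrite mulr1.
rewrite /quad_sum /conf_sum -big_enum /=.
(* By injectivity and surjectivity, [quad_conf n] lists each configuration of weight [n] exactly
   once. *)
rewrite [RHS](perm_big [seq quad_conf n l | l <- D]) /=; last first.
  rewrite perm_sym; apply: uniq_perm; rewrite ?enum_uniq //.
    rewrite map_inj_in_uniq ?fset_uniq // => l l' lD lD'.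
    by apply: quad_conf_inj; rewrite inE -inD.
  move=> f; rewrite mem_enum; apply/mapP/idP => [[l]|/quad_conf_onto[l ln <-]].
    by rewrite inD => /eqP ln ->; apply: quad_conf_ok.
  by exists l; rewrite // inD ln.
rewrite big_map; apply: eq_big_seq => l; rewrite inD => /eqP ln.
by rewrite quad_conf_crank.
Qed.

End Quadruples.

Theorem theorem3p1 (Delta : pds -> partition_pair)
    (Delta_bij : pds_bijection Delta) (n k : nat) (le_kn : (k <= n)%N) :
  0 < (-1) ^+ n * mu_bd Delta k n.
Proof.
rewrite (mu_bd_quad_sum Delta_bij).
by have [_] := mu_alt_ge0_gt0 (leqnn n) k; apply.
Qed.
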